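(* Let $\phi$ be a (normalized) flow on the Poincaré hemisphere $\mathcal{H}$ and let $S\subset\mathcal{E}$ be a closed invariant set in the sphere at infinity which is of isolated invariant dynamical complement, i.e. its dynamical complement $S_{comp}$ is isolated invariant, so that the Conley index at infinity $\hat{h}(S)$ is well defined. 1. If $\hat{h}(S)$ is the index of a repeller, then there exists $x\in\mathcal{H}\setminus(S\cup S_{comp})$ with $\alpha(x)\cap S\neq\emptyset$ and $\omega(x)\subset S_{comp}$, and there is no trajectory $S_{comp}\to S$, i.e. there is no $x\in\mathcal{H}\setminus(S\cup S_{comp})$ with $\alpha(x)\subset S_{comp}$ and $\omega(x)\cap S\neq\emptyset$. 2. If $\hat{h}(S)$ is the index of an attractor, then there exists $x\in\mathcal{H}\setminus(S\cup S_{comp})$ with $\alpha(x)\subset S_{comp}$ and $\omega(x)\cap S\neq\emptyset$, and there is no trajectory $S\to S_{comp}$, i.e. there is no $x\in\mathcal{H}\setminus(S\cup S_{comp})$ with $\alpha(x)\cap S\neq\emptyset$ and $\omega(x)\subset S_{comp}$. 3. If $\hat{h}(S)$ is neither the index of an attractor nor the index of a repeller, then there exist $x,y\in\mathcal{H}\setminus(S\cup S_{comp})$ with $\alpha(x)\cap S\neq\emptyset$, $\omega(x)\subset S_{comp}$, and $\alpha(y)\subset S_{comp}$, $\omega(y)\cap S\neq\emptyset$.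
   Context: Poincaré hemisphere and flows. $X$ is a finite-dimensional real vector space with scalar product $\langle\cdot,\cdot\rangle$; $\mathcal{H}=\{(\chi,z)\in X\times\mathbb{R}:\langle\chi,\chi\rangle+z^2=1,\ z\ge 0\}$ is the Poincaré hemisphere and $\mathcal{E}=\{(\chi,0):\langle\chi,\chi\rangle=1\}$ its equator (boundary), called the sphere at infinity. A vector field $f:X\to X$ is normalizable if there is a continuous $\rho:[0,\infty)\to[0,\infty)$ with $\rho(z)\ne 0$ for $z\neq 0$ such that $(\chi,z)\mapsto\rho(z)\,z f(z^{-1}\chi)$ extends to a map $F$ on $\mathcal{H}$ that is Lipschitz continuous, even at $z=0$. A (normalized) flow on $\mathcal{H}$ means the flow $\phi:\mathbb{R}\times\mathcal{H}\to\mathcal{H}$ of $\dot\chi=F-\langle F,\chi\rangle\chi$, $\dot z=-\langle F,\chi\rangle z$ for such an $F$; it leaves $\mathcal{E}$ invariant. Conventions. Closure, interior, boundary ($cl_{\mathcal{H}}$, $int_{\mathcal{H}}$, $\partial_{\mathcal{H}}$) are relative to $\mathcal{H}$. $\alpha(x),\omega(x)$ are the $\alpha$- and $\omega$-limit sets of $x$ under $\phi$. Invariant means forward and backward invariant. A compact neighbourhood is a compact set $K\subset\mathcal{H}$ with $K=cl_{\mathcal{H}}(int_{\mathcal{H}}K)$; $Inv(K)$ is the maximal invariant subset of $K$. A set $R$ is isolated invariant if $R=Inv(K)\subset int_{\mathcal{H}}(K)$ for some compact neighbourhood $K$ (an isolating neighbourhood of $R$). Dynamical complement. For a closed invariant set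 $S$, $S_{comp}:=\{x\in\mathcal{H}:\alpha(x)\cap S=\omega(x)\cap S=\emptyset\}$. $S$ is of isolated invariant dynamical complement if $S_{comp}$ is isolated invariant. Conley index. An index pair for an isolated invariant set $R$ under a flow $\psi$ on $\mathcal{H}$ is a pair of compact sets $N_1\subset N$ such that (i) $cl_{\mathcal{H}}(N\setminus N_1)$ is an isolating neighbourhood for $R$; (ii) for $x\in N_1$, $t>0$, $\psi([0,t],x)\subseteq N$ implies $\psi([0,t],x)\subseteq N_1$; (iii) if $x\in N$, $t_1>0$ and $\psi(t_1,x)\notin N$, there is $t_0\in[0,t_1]$ with $\psi([0,t_0],x)\subseteq N$ and $\psi(t_0,x)\in N_1$. With $*$ an additional universal point, the Conley index of $R$ is the triple of homotopy types of pointed spaces $h(\mathcal{H};R)=\left[\frac{N\cup\{*\}}{N_1\cup\{*\}}\right]$, $h(\mathcal{H},\mathcal{E};R)=\left[\frac{N\cup\{*\}}{N_1\cup(N\cap\mathcal{E})\cup\{*\}}\right]$, $h(\mathcal{E};R)=\left[\frac{(N\cap\mathcal{E})\cup\{*\}}{(N_1\cap\mathcal{E})\cup\{*\}}\right]$; it does not depend on the index pair. Conley index at infinity. For an invariant $S\subset\mathcal{E}$ of isolated invariant dynamical complement, $\hat h(S)$ is the Conley index of $S_{comp}$ computed under the time-reversed flow $\phi_-(t,\cdot):=\phi(-t,\cdot)$. Indices of attractors and repellers. The Conley index of an isolated invariant set is called the index of an attractor if it comes from an index pair (of that set, for the flow under which the index is computed) of the form $(B,\emptyset)$, and the index of a repeller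 if it comes from an index pair of the form $(B,\partial_{\mathcal{H}}B)$. For $\hat h(S)$ the isolated invariant set is $S_{comp}$ and the flow is $\phi_-$.
   Formalization: The existence assertions of parts 1 and 2 are stated only when S and S_comp are both nonempty; they fail otherwise (S empty gives S_comp = H; S_comp empty cannot contain a nonempty limit set). The non-existence assertions and part 3 are unrestricted. *)

(* Defs.v *)
From HB Require Import structures.
From mathcomp Require Import all_boot all_order all_algebra.
From mathcomp Require Import generic_quotient.
From mathcomp Require Import all_classical all_reals all_analysis.

Set Implicit Arguments.
Unset Strict Implicit.
Unset Printing Implicit Defensive.

Import Order.TTheory GRing.Theory Num.Theory.
Import numFieldNormedType.Exports.

Local Open Scope classical_set_scope.
Local Open Scope ring_scope.

(* Closure, interior and compactness below are those of the topological type
   [M]. For the hemisphere, [M] is the [set_type] carrying the subspace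
   topology, so that they are relative to the hemisphere. *)

Section Dynamics.
Variables (R : realType) (M : topologicalType).
Implicit Types (phi : R -> M -> M) (A K N S : set M).

Definition is_flow phi : Prop :=
  [/\ continuous (fun p : R * M => phi p.1 p.2),
      forall x, phi 0 x = x &
      forall s t x, phi (s + t) x = phi s (phi t x)].

Definition reverse_flow phi : R -> M -> M := fun t => phi (- t).

Definition omega_limit phi (x : M) : set M := cluster (phi ^~ x @ +oo).

Definition alpha_limit phi (x : M) : set M := cluster (phi ^~ x @ -oo).

Definition invariant_set phi A : Prop := forall t x, A x -> A (phi t x).

Definition max_invariant phi K : set M :=
  \bigcup_(A in [set A | invariant_set phi A /\ A `<=` K]) A.

Definition boundary A : set M := closure A `\` interior A.

Definition compact_neighbourhood K : Prop :=
  compact K /\ K = closure (interior K).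

Definition isolating_neighbourhood phi A K : Prop :=
  [/\ compact_neighbourhood K, A = max_invariant phi K & A `<=` interior K].

Definition isolated_invariant phi A : Prop :=
  exists K, isolating_neighbourhood phi A K.

Definition dyn_complement phi S : set M :=
  [set x | alpha_limit phi x `&` S = set0 /\ omega_limit phi x `&` S = set0].

Definition orbit_segment phi (t : R) (x : M) : set M :=
  (phi ^~ x) @` `[0, t].

Record index_pair phi A N N1 : Prop := IndexPair {
  index_pair_compact : compact N;
  index_pair_compact1 : compact N1;
  index_pair_sub : N1 `<=` N;
  index_pair_isolating :
    isolating_neighbourhood phi A (closure (N `\` N1));
  index_pair_positive : forall x t, N1 x -> 0 < t ->
    orbit_segment phi t x `<=` N -> orbit_segment phi t x `<=` N1;
  index_pair_exit : forall x t1, N x -> 0 < t1 -> ~ N (phi t1 x) ->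
    exists t0, [/\ 0 <= t0 <= t1, orbit_segment phi t0 x `<=` N
                 & N1 (phi t0 x)] }.

End Dynamics.

Section PointedQuotient.
Local Open Scope quotient_scope.
Variables (M : topologicalType) (N N1 : set M).

(* For compact [N], the added point [None] of the one-point compactification
   is isolated, hence this is the topological sum of [N] and [*]. *)
Local Notation add_point := (one_point_compactification (set_type N)).

Definition collapsed (x : add_point) : bool :=
  if x is Some y then `[< N1 (set_val y) >] else true.

Definition collapse_rel (x y : add_point) : bool :=
  (x == y) || (collapsed x && collapsed y).

Lemma collapse_rel_refl : reflexive collapse_rel.
Proof. by move=> x; rewrite /collapse_rel eqxx. Qed.

Lemma collapse_rel_sym : symmetric collapse_rel.
Proof. by move=> x y; rewrite /collapse_rel eq_sym andbC. Qed.

Lemma collapse_rel_trans : transitive collapse_rel.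
Proof.
move=> y x z /orP[/eqP->//|/andP[cx cy]] /orP[/eqP<-|/andP[_ cz]].
  by rewrite /collapse_rel cx cy orbT.
by rewrite /collapse_rel cx cz orbT.
Qed.

Definition collapse_equiv :=
  EquivRel _ collapse_rel_refl collapse_rel_sym collapse_rel_trans.

Definition index_space : Type := {eq_quot collapse_equiv}.
HB.instance Definition _ := Quotient.on index_space.
HB.instance Definition _ :=
  Topological.copy index_space (quotient_topology index_space).
HB.instance Definition _ := isPointed.Build index_space
  (\pi_index_space (None : add_point)).

End PointedQuotient.

Section Homotopy.
Variable R : realType.

Definition pointed_map (Y Z : ptopologicalType) (f : Y -> Z) : Prop :=
  continuous f /\ f point = point.

Definition pointed_homotopic (Y Z : ptopologicalType) (f g : Y -> Z) : Prop :=
  exists h : R * Y -> Z,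
    [/\ {within `[0, 1] `*` setT, continuous h},
        forall y, h (0, y) = f y,
        forall y, h (1, y) = g y &
        forall t : R, 0 <= t <= 1 -> h (t, point) = point].

Definition pointed_homotopy_equivalent (Y Z : ptopologicalType) : Prop :=
  exists (f : Y -> Z) (g : Z -> Y),
    [/\ pointed_map f, pointed_map g,
        pointed_homotopic (g \o f) id & pointed_homotopic (f \o g) id].

End Homotopy.

Section ConleyIndex.
Variables (R : realType) (M : topologicalType) (E : set M).
Implicit Types (phi : R -> M -> M) (A N S : set M).

Record pointed_triple := PointedTriple {
  space_M : ptopologicalType;
  space_ME : ptopologicalType;
  space_E : ptopologicalType }.

Definition triple_equivalent (T T' : pointed_triple) : Prop :=
  [/\ pointed_homotopy_equivalent R (space_M T) (space_M T'),
      pointed_homotopy_equivalent R (space_ME T) (space_ME T') &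
      pointed_homotopy_equivalent R (space_E T) (space_E T')].

Definition index_triple N N1 : pointed_triple :=
  PointedTriple (index_space N N1)
                (index_space N (N1 `|` (N `&` E)))
                (index_space (N `&` E) (N1 `&` E)).

(* A triple of homotopy types is represented by the class of all triples of
   pointed spaces having these homotopy types. Since the triples of any two
   index pairs of [A] are equivalent, the class below is a single one. *)
Definition conley_index phi A : pointed_triple -> Prop :=
  fun T => exists N N1,
    index_pair phi A N N1 /\ triple_equivalent T (index_triple N N1).

Definition comes_from phi A (h : pointed_triple -> Prop) N N1 : Prop :=
  index_pair phi A N N1 /\ h (index_triple N N1).

Definition index_of_attractor phi A (h : pointed_triple -> Prop) : Prop :=
  exists B, comes_from phi A h B set0.

Definition index_of_repeller phi A (h : pointed_triple -> Prop) : Prop :=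
  exists B, comes_from phi A h B (boundary B).

Definition index_at_infinity phi S : pointed_triple -> Prop :=
  conley_index (reverse_flow phi) (dyn_complement phi S).

Definition infinity_attractor phi S : Prop :=
  index_of_attractor (reverse_flow phi) (dyn_complement phi S)
    (index_at_infinity phi S).

Definition infinity_repeller phi S : Prop :=
  index_of_repeller (reverse_flow phi) (dyn_complement phi S)
    (index_at_infinity phi S).

End ConleyIndex.

Section PoincareHemisphere.
Variables (R : realType) (X : normedModType R) (ip : X -> X -> R).

Definition finite_dimensional : Prop :=
  exists n (e : 'I_n -> X), forall x,
    exists c : 'I_n -> R, x = \sum_(i < n) c i *: e i.

(* The last clause makes [ip] positive definite and says that the norm, hence
   the topology, of [X] is the one given by [ip]. *)
Definition scalar_product : Prop :=
  [/\ forall v, scalar (ip ^~ v),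
      forall u v, ip u v = ip v u &
      forall u, ip u u = `|u| ^+ 2].

Definition hemisphere : set (X * R) :=
  [set p | ip p.1 p.1 + p.2 ^+ 2 = 1 /\ 0 <= p.2].

Definition equator : set hemisphere := [set p | (set_val p).2 = 0].

(* [rho] is only relevant on [0, +oo[. *)
Definition normalization (f : X -> X) (rho : R -> R) (F : hemisphere -> X) :
    Prop :=
  [/\ {within `[0, +oo[, continuous rho},
      forall z : R, 0 <= z -> 0 <= rho z,
      forall z : R, 0 < z -> rho z != 0,
      forall p : hemisphere, let: (chi, z) := set_val p in
        0 < z -> F p = (rho z * z) *: f (z^-1 *: chi) &
      exists L : R, forall p q : hemisphere,
        `|F p - F q| <= L * `|set_val p - set_val q|].

Definition generated_by (F : hemisphere -> X)
    (phi : R -> hemisphere -> hemisphere) : Prop :=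
  forall (p : hemisphere) (t : R),
    let chi s := (set_val (phi s p)).1 in
    let z s := (set_val (phi s p)).2 in
    let v := F (phi t p) in
    is_derive t 1 chi (v - ip v (chi t) *: chi t) /\
    is_derive t 1 z (- ip v (chi t) * z t).

Definition normalized_flow (phi : R -> hemisphere -> hemisphere) : Prop :=
  is_flow phi /\
  exists f rho F, normalization f rho F /\ generated_by F phi.

End PoincareHemisphere.

Arguments equator {R X} ip.

(* Main.v *)
Require Import Defs.
From mathcomp Require Import all_boot all_order all_algebra.
From mathcomp Require Import ring lra.
From mathcomp Require Import all_classical all_reals all_analysis.
Import Order.TTheory GRing.Theory Num.Theory.
Import numFieldNormedType.Exports.

Set Implicit Arguments.
Unset Strict Implicit.
Unset Printing Implicit Defensive.

Local Open Scope classical_set_scope.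
Local Open Scope ring_scope.

(** Write [C] for the dynamical complement of [S]. Limit sets being nonempty,
    [C] is disjoint from [S]. So a point outside [C] whose omega-limit set lies
    in [C] has an alpha-limit set meeting [S]: finding a trajectory from [S] to
    [C] amounts to finding a point outside [C] that is attracted by [C].

    The indices enter only through attraction. An index pair of the form
    [(B, set0)] for a flow has no exit set, so [B] is positively invariant; an
    index pair of the form [(B, boundary B)] makes the interior of [B]
    positively invariant for the reversed flow, since an orbit coming from the
    boundary has to stay in it as long as it stays in [B]. Conversely, a
    positively invariant isolating neighbourhood of [C] yields such pairs. Hence
    [index_of_attractorP] and [index_of_repellerP]: the index at infinity is
    that of a repeller (resp. attractor) if and only if [C] is [trapping] for
    [phi] (resp. for the reversed flow).

    If [C] is trapping, an orbit issued from [C] cannot go away from it, which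
    excludes connections from [C] to [S]. A connection from [S] to [C]
    exists as the hemisphere is connected: a positively invariant neighbourhood
    of [C] has points outside [C] unless [C] is open and closed
    ([trapping_connection]).

    If [C] attracts no point outside itself, every point of the frontier of an
    isolating neighbourhood [K] escapes from [K], by compactness within a
    bounded time. A backward orbit starting close enough to [C] stays in [K]
    longer than that time, and cannot reach the frontier later. So [C] is
    trapping for the reversed flow ([trapping_reverse]); the contrapositive, for
    [phi] and for its reversal, gives both connections of the third case.

    Of the hemisphere one uses that it is compact, connected and Hausdorff.
    It is the image of a compact subset of [X], and a union of continuous images
    of segments through the pole, under the map that retracts [X] onto the
    unit ball and then lifts the ball vertically. *)

(** * Flows, reversal and limit sets *)

Section Flows.
Variables (R : realType) (M : topologicalType).
Implicit Types (phi : R -> M -> M) (A K S : set M).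

Definition positively_invariant phi A : Prop :=
  forall x t, A x -> 0 <= t -> A (phi t x).

(** [A] attracts a neighbourhood of itself; only isolated invariant sets are
    considered, so that the neighbourhood can be required to isolate [A]. *)
Definition trapping phi A : Prop :=
  exists K, isolating_neighbourhood phi A K /\ positively_invariant phi K.

Lemma reverse_flowK phi : reverse_flow (reverse_flow phi) = phi.
Proof. by apply/funext => t; rewrite /reverse_flow opprK. Qed.

Lemma reverse_is_flow phi : is_flow phi -> is_flow (reverse_flow phi).
Proof.
move=> [cphi phi0 phiD]; split=> [|x|s t x]; rewrite /reverse_flow.
- move=> p; apply: (@continuous_comp _ _ _ (fun p : R * M => (- p.1, p.2))
    (fun p : R * M => phi p.1 p.2)); last exact: cphi.
  have c1 : - q.1 @[q --> p] --> - p.1 by apply: cvgN; exact: cvg_fst.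
  exact: (cvg_pair c1 (@cvg_snd _ _ _ _ _)).
- by rewrite oppr0.
- by rewrite opprD.
Qed.

Lemma flowK phi t : is_flow phi -> cancel (phi t) (phi (- t)).
Proof. by move=> [_ phi0 phiD] x; rewrite -phiD addNr. Qed.

Lemma flowKV phi t : is_flow phi -> cancel (phi (- t)) (phi t).
Proof. by move=> [_ phi0 phiD] x; rewrite -phiD subrr. Qed.

Lemma flow_continuous_state phi t : is_flow phi -> continuous (phi t).
Proof.
move=> [cphi _ _] x; apply: (@continuous_comp _ _ _ (fun y => (t, y))
  (fun p : R * M => phi p.1 p.2)); last exact: cphi.
by apply: (cvg_pair (@cvg_cst _ t _ _ _) (@cvg_id _ _)).
Qed.

Lemma flow_continuous_time phi x : is_flow phi -> continuous (phi ^~ x).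
Proof.
move=> [cphi _ _] t; apply: (@continuous_comp _ _ _ (fun y => (y, x))
  (fun p : R * M => phi p.1 p.2)); last exact: cphi.
by apply: (cvg_pair (@cvg_id _ _) (@cvg_cst _ x _ _ _)).
Qed.

Lemma invariant_set_reverse phi A :
  invariant_set (reverse_flow phi) A <-> invariant_set phi A.
Proof.
split=> + t x Ax => [/(_ (- t) x Ax)|]; first by rewrite /reverse_flow opprK.
exact.
Qed.

Lemma isolating_neighbourhood_reverse phi A K :
  isolating_neighbourhood (reverse_flow phi) A K <->
  isolating_neighbourhood phi A K.
Proof.
have E : max_invariant (reverse_flow phi) K = max_invariant phi K.
  apply/seteqP; split=> x [C [invC CK] Cx]; exists C => //;
    by split=> //; apply/invariant_set_reverse; rewrite ?reverse_flowK.
by rewrite /isolating_neighbourhood E.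
Qed.

Lemma alpha_limit_reverse phi x :
  alpha_limit (reverse_flow phi) x = omega_limit phi x.
Proof. by rewrite /alpha_limit /omega_limit -ninftyN. Qed.

Lemma omega_limit_reverse phi x :
  omega_limit (reverse_flow phi) x = alpha_limit phi x.
Proof. by rewrite -alpha_limit_reverse reverse_flowK. Qed.

Lemma dyn_complement_reverse phi S :
  dyn_complement (reverse_flow phi) S = dyn_complement phi S.
Proof.
apply/seteqP; split=> x [] /=;
  by rewrite ?alpha_limit_reverse ?omega_limit_reverse; split;
     rewrite ?alpha_limit_reverse ?omega_limit_reverse.
Qed.

(** Each time map is a homeomorphism, hence sends interior points of [A] to
    interior points of its image, which [A] contains. *)
Lemma positively_invariant_interior phi A : is_flow phi ->
  positively_invariant phi A -> positively_invariant phi (interior A).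
Proof.
move=> fphi pA x t /= Ax t0; rewrite /interior /=.
have : nbhs (phi t x) (phi (- t) @^-1` A).
  by apply: (@flow_continuous_state _ (- t) fphi (phi t x)); rewrite flowK.
by apply: filterS => y /= /pA /(_ t0); rewrite flowKV.
Qed.

Lemma positively_invariant_closure phi A : is_flow phi ->
  positively_invariant phi A -> positively_invariant phi (closure A).
Proof.
move=> fphi pA x t /= clx t0 B nB.
have [y [Ay By]] := clx _ (flow_continuous_state fphi nB).
by exists (phi t y); split=> //; exact: pA.
Qed.

Lemma omega_limit_eventually phi x s A : is_flow phi -> closed A ->
  (forall t, s <= t -> A (phi t x)) -> omega_limit phi x `<=` A.
Proof.
move=> fphi cA HA y cy; apply: cA => B nB; apply: cy => //=.
exists s; split; first exact: num_real.
by move=> t /ltW; exact: HA.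
Qed.

Lemma omega_limit_frequently phi x s y U : omega_limit phi x y -> nbhs y U ->
  exists2 t, s <= t & U (phi t x).
Proof.
move=> oy nU.
have /oy /(_ nU) [_ [[t st <-] Ut]] :
    (phi ^~ x @ +oo) [set phi t x | t in [set t | s <= t]].
  exists s; split; first exact: num_real.
  by move=> t /ltW st; exists t.
by exists t.
Qed.

Lemma invariant_omega_limit phi x : is_flow phi ->
  invariant_set phi (omega_limit phi x).
Proof.
move=> fphi t y oy A B [s [_ HA]] nB.
have [r rs Br] := omega_limit_frequently (s + 1 - t) oy
  (flow_continuous_state fphi nB).
exists (phi t (phi r x)); split=> //.
case: (fphi) => _ _ <-; apply: HA.
by move: rs; rewrite lerBlDl; apply: lt_le_trans; rewrite ltrDl.
Qed.

Lemma closed_invariant_omega_limit phi x A : is_flow phi ->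
  closed A -> invariant_set phi A -> A x -> omega_limit phi x `<=` A.
Proof.
move=> fphi cA iA Ax.
by apply: (@omega_limit_eventually _ _ 0) => // t _; exact: iA.
Qed.

Lemma omega_limit_in_max_invariant phi x s K : is_flow phi -> closed K ->
  (forall t, s <= t -> K (phi t x)) ->
  omega_limit phi x `<=` max_invariant phi K.
Proof.
move=> fphi cK HK y oy; exists (omega_limit phi x) => //; split.
  exact: invariant_omega_limit.
exact: omega_limit_eventually HK.
Qed.

(** The times in [`[0, s]] at which [g] is outside [U] form a compact set, which
    has a least element. *)
Lemma first_exit (g : R -> M) U s : continuous g -> open U -> 0 <= s ->
  ~ U (g s) ->
  exists t, [/\ 0 <= t <= s, ~ U (g t) & forall r, 0 <= r < t -> U (g r)].
Proof.
move=> cg oU s0 nUs; pose C := `[0, s]%classic `&` g @^-1` (~` U).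
have cC : compact C.
  apply: compact_closedI; first exact: segment_compact.
  by move/continuous_closedP : cg; apply; exact: open_closedC.
have C0 : C !=set0 by exists s; split=> //=; rewrite in_itv/= s0 lexx.
have cid : {within C, continuous (id : R -> R)}.
  by apply: continuous_subspaceT => x; exact: cvg_id.
have [t /set_mem[/= + nUt] tmin] := compact_EVT_min C0 cC cid.
rewrite in_itv/= => ts; exists t; split=> //.
move=> r /andP[r0 rt]; apply: contrapT => nUr.
have /(_ _)/= := tmin r; rewrite leNgt rt => /(_ _)/notF; apply.
apply/mem_set; split=> //=; rewrite in_itv/= r0 (le_trans (ltW rt))//.
by case/andP: ts.
Qed.

(** Before the first exit time from the interior the orbit is in [B], and at
    that time it still is because [B] is closed. *)
Lemma first_exit_interior phi B x s : is_flow phi -> closed B -> B x ->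
  0 <= s -> ~ interior B (phi s x) ->
  exists t, [/\ 0 <= t <= s, ~ interior B (phi t x),
                forall r, 0 <= r < t -> interior B (phi r x)
              & orbit_segment phi t x `<=` B].
Proof.
move=> fphi cB Bx s0 nIs.
have [t [ts nIt It]] := first_exit (flow_continuous_time (x := x) fphi)
  (@open_interior _ _) s0 nIs.
have Bt : B (phi t x).
  have [->|t0] := eqVneq t 0; first by case: (fphi) => _ -> _.
  apply: cB => A /(flow_continuous_time fphi) nA.
  have t0' : 0 < t by rewrite lt_def t0; case/andP: ts.
  near (t^'-) => r.
  exists (phi r x); split; last by near: r; apply: cvg_within.
  apply: interior_subset; apply: It; apply/andP; split.
    by near: r; exact: nbhs_left_ge.
  by near: r; exact: nbhs_left_lt.
exists t; split=> // _ [r /= + <-]; rewrite in_itv/= => /andP[r0].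
rewrite le_eqVlt => /predU1P[->//|rt].
by apply: interior_subset; apply: It; rewrite r0.
Unshelve. all: end_near. Qed.

End Flows.

(** * Attraction on a compact phase space *)

Section CompactFlows.
Variables (R : realType) (M : topologicalType).
Hypotheses (cM : compact [set: M]) (hM : hausdorff_space M).
Implicit Types (phi psi : R -> M -> M) (A K S : set M).

Lemma closure_sub_closed A K : closed K -> A `<=` K -> closure A `<=` K.
Proof. by move=> cK /closure_subset; rewrite -(closure_id K).1. Qed.

Lemma closed_compact A : closed A -> compact A.
Proof. by move=> cA; apply: (subclosed_compact cA cM). Qed.

Lemma omega_limit_neq0 phi x : omega_limit phi x !=set0.
Proof.
have [y [_ oy]] := cM (F := phi ^~ x @ +oo) _ filterT.
by exists y.
Qed.

Lemma isolating_closed phi A K : isolating_neighbourhood phi A K -> closed K.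
Proof. by move=> [[cK _] _ _]; exact: compact_closed. Qed.

(** The closure of the maximal invariant set of a closed set is an invariant
    subset of that closed set. *)
Lemma isolated_closed phi A :
  is_flow phi -> isolated_invariant phi A -> closed A.
Proof.
move=> fphi [K isoK]; have cK := isolating_closed isoK.
case: isoK => _ EA _.
have iA : invariant_set phi A.
  move=> t x; rewrite EA => -[C [iC CK] Cx]; exists C => //; exact: iC.
have icl : invariant_set phi (closure A).
  move=> t x clx B nB.
  have [y [Ay By]] := clx _ (flow_continuous_state fphi nB).
  by exists (phi t y); split=> //; exact: iA.
move=> x clx; rewrite EA; exists (closure A) => //; split=> //.
apply: closure_sub_closed cK _.
by rewrite EA => y [C [_ CK] Cy]; exact: CK.
Qed.

Lemma trapped_omega_limit phi A K x s : is_flow phi ->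
  isolating_neighbourhood phi A K -> positively_invariant phi K ->
  K (phi s x) -> omega_limit phi x `<=` A.
Proof.
move=> fphi isoK pK Ks; rewrite (let: And3 _ E _ := isoK in E).
apply: (@omega_limit_in_max_invariant _ _ _ _ s) => //.
  exact: isolating_closed isoK.
move=> t st; rewrite -(subrK s t); case: (fphi) => _ _ ->.
by apply: pK => //; rewrite subr_ge0.
Qed.

(** A point whose alpha-limit set meets [A] visits the trapping neighbourhood at
    some time, and is attracted by [A] from then on. *)
Lemma trapping_no_departure phi A S x : is_flow phi -> trapping phi A ->
  A `&` S = set0 -> alpha_limit phi x `<=` A ->
  ~ (omega_limit phi x `&` S !=set0).
Proof.
move=> fphi [K [isoK pK]] AS0 aA [y [oy Sy]].
have [z az] : alpha_limit phi x !=set0.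
  by rewrite -omega_limit_reverse; exact: omega_limit_neq0.
have nK : nbhs z (interior K).
  apply: open_nbhs_nbhs; split; first exact: open_interior.
  by case: isoK => _ _; apply; exact: aA.
move: az; rewrite -omega_limit_reverse.
move=> /omega_limit_frequently/(_ nK) => /(_ 0).
move=> [t _ /interior_subset Kt].
have := trapped_omega_limit fphi isoK pK Kt oy.
by move=> Ay; suff: set0 y by []; rewrite -AS0.
Qed.

(** A trapping neighbourhood reduced to [A] would make [A] open and closed;
    otherwise any of its points outside [A] is attracted by [A]. *)
Lemma trapping_arrival phi A : is_flow phi -> trapping phi A ->
  connected [set: M] -> A !=set0 -> A != setT ->
  exists x, ~ A x /\ omega_limit phi x `<=` A.
Proof.
move=> fphi [K [isoK pK]] coM A0 AT.
have cA : closed A by apply: isolated_closed fphi _; exists K.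
have [KA|/existsNP[x /not_implyP[Kx nAx]]] := pselect (K `<=` A).
  have oA : open A.
    have -> : A = interior K; last exact: open_interior.
    by apply/seteqP; split=> [|x /interior_subset/KA//]; case: isoK.
  exfalso; move/eqP: AT; apply; apply: coM => //.
    by exists A => //; rewrite setTI.
  by exists A => //; rewrite setTI.
exists x; split=> //; apply: (trapped_omega_limit (s := 0)) isoK pK _ => //.
by case: (fphi) => _ -> _.
Qed.

(** Being outside [K] at some time between [0] and [T] is an open condition,
    implied by the same condition for a smaller [T]: compactness of [D] yields a
    common bound. *)
Lemma uniform_escape phi K D : is_flow phi -> closed K -> compact D ->
  (forall x, D x -> exists2 t, 0 <= t & ~ K (phi t x)) ->
  exists2 T : R, 0 <= T &
    forall x, D x -> exists2 t, 0 <= t <= T & ~ K (phi t x).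
Proof.
move=> fphi cK /compact_near_coveringP cD HD.
have [T [_ HT]] : \forall T \near +oo,
    D `<=` (fun x => exists2 t : R, 0 <= t <= T & ~ K (phi t x)).
  apply: cD => x /HD [t t0 nK].
  have nbK : nbhs (phi t x) (~` K).
    by apply: open_nbhs_nbhs; split=> //; exact: closed_openC.
  exists (phi t @^-1` (~` K), [set T | t <= T]) => /=.
    split; first exact: (flow_continuous_state fphi nbK).
    by apply: nbhs_pinfty_ge; exact: num_real.
  by move=> [y T] /= [nKy tT]; exists t => //; rewrite t0.
exists (Num.max 0 (T + 1)); first by rewrite le_max lexx.
by apply: HT; rewrite lt_max ltrDl ltr01 orbT.
Qed.

Lemma tube_nbhs phi U T x : is_flow phi -> open U ->
  (forall s, 0 <= s <= T -> U (phi s x)) ->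
  \forall y \near x, forall s, 0 <= s <= T -> U (phi s y).
Proof.
move=> fphi oU HU.
have /compact_near_coveringP cI := @segment_compact R 0 T.
have : \forall y \near x, `[0, T]%classic `<=` (fun s => U (phi s y)).
  apply: cI => s /=; rewrite in_itv/= => /HU Us.
  case: fphi => cphi _ _; apply: (cphi (s, x)).
  by apply: open_nbhs_nbhs.
by apply: filterS => y H s sT; apply: H; rewrite /= in_itv.
Qed.

(** The crux of the third case. Suppose a backward orbit spends a time at least
    [T] in [interior K] and then reaches the frontier of [K]; followed forward
    from there, it stays in [K] at least during [T]. This is impossible if [T]
    bounds the escape times of frontier points. By continuity, the orbits of
    all points close to [A] spend a time [T] in [interior K]. *)
Lemma trapping_reverse phi A : is_flow phi -> isolated_invariant phi A ->
  (forall x, omega_limit phi x `<=` A -> A x) -> trapping (reverse_flow phi) A.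
Proof.
move=> fphi [K isoK] HA; have cK := isolating_closed isoK.
have fpsi := reverse_is_flow fphi; set psi := reverse_flow phi in fpsi *.
have [_ EA AK] := isoK.
have [T T0 HT] : exists2 T : R, 0 <= T & forall x, (K `\` interior K) x ->
    exists2 t, 0 <= t <= T & ~ K (phi t x).
  apply: uniform_escape => //.
    apply/closed_compact; rewrite setDE; apply: closedI => //.
    by apply: open_closedC; exact: open_interior.
  move=> x [Kx nIx]; apply: contrapT => H; apply/nIx/AK/HA; rewrite EA.
  apply: (@omega_limit_in_max_invariant _ _ _ _ 0) => // t t0.
  by apply: contrapT => nK; apply: H; exists t.
(* Points whose whole reversed orbit stays in the interior of [K]; the interior
   of this set is the trapping set sought, once it is known to contain [A]. *)
pose P := [set x | forall s, 0 <= s -> interior K (psi s x)].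
have pP : positively_invariant psi P.
  move=> x t Px t0 s s0; case: (fpsi) => _ _ <-.
  by apply: Px; exact: addr_ge0.
pose V := [set x | forall s, 0 <= s <= T -> interior K (psi s x)].
have VP : V `<=` P.
  move=> x Vx s s0; apply: contrapT => nI.
  have Kx : K x.
    apply: interior_subset; have := Vx 0; rewrite lexx T0.
    by case: (fpsi) => _ -> _; exact.
  have [r [/andP[r0 rs] nIr Ir segK]] :=
    first_exit_interior fpsi cK Kx s0 nI.
  have Kr : K (psi r x).
    by apply: segK; exists r => //=; rewrite in_itv/= r0 lexx.
  have Tr : T < r.
    by rewrite ltNge; apply/negP => rT; apply: nIr; apply: Vx; rewrite r0.
  (* Following [phi] from the exit point retraces the reversed orbit. *)
  have back t : phi t (psi r x) = psi (r - t) x.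
    by case: (fphi) => _ _ phiD; rewrite /psi /reverse_flow -phiD opprB.
  have [t /andP[t0 tT]] := HT _ (conj Kr nIr).
  rewrite back; apply.
  have [->|t_neq0] := eqVneq t 0; first by rewrite subr0.
  apply: interior_subset; apply: Ir.
  rewrite subr_ge0 (le_trans tT (ltW Tr))/= ltrBlDr ltrDl.
  by rewrite lt_def t_neq0.
have iA : invariant_set psi A.
  apply/invariant_set_reverse => t x; rewrite EA => -[C [iC CK] Cx].
  by exists C => //; exact: iC.
have AP : A `<=` interior P.
  move=> x Ax; suff : nbhs x V by apply: filterS.
  apply: tube_nbhs => //; first exact: open_interior.
  by move=> s _; apply: AK; exact: iA.
pose W := interior P.
have PK : P `<=` K.
  by move=> x /(_ 0 (lexx _)) /interior_subset; case: (fpsi) => _ -> _.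
have pW : positively_invariant psi W by exact: positively_invariant_interior.
have clWK : closure W `<=` K.
  apply: closure_sub_closed cK _.
  exact: subset_trans (@interior_subset _ _) PK.
have WI : W `<=` interior (closure W).
  by rewrite -open_subsetE; [exact: subset_closure|exact: open_interior].
exists (closure W); split; last exact: positively_invariant_closure.
split.
- split; first exact/closed_compact/closed_closure.
  apply/seteqP; split; first exact: closureS.
  by apply: closure_sub_closed (@closed_closure _ _) _; exact: interior_subset.
- apply/seteqP; split=> x.
    move=> Ax; exists A => //; split=> //.
    by apply: subset_trans AP _; exact: subset_closure.
  rewrite EA => -[C [iC CW] Cx]; exists C => //; split.
    exact/invariant_set_reverse.
  exact: subset_trans CW clWK.
- exact: subset_trans AP WI.
Qed.

(** * Indices of attractors and repellers *)

Variable E : set M.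

Lemma pointed_homotopy_equivalent_refl (Y : ptopologicalType) :
  pointed_homotopy_equivalent R Y Y.
Proof.
have Hid : pointed_homotopic R (@id Y) id.
  exists snd; split=> //.
  by apply: continuous_subspaceT => x; exact: cvg_snd.
by exists id, id; split=> //; split=> // x; exact: cvg_id.
Qed.

(** The homotopy types computed from an index pair represent the Conley index by
    definition, so that coming from a pair imposes nothing more than being one. *)
Lemma comes_from_conley_index psi A N N1 :
  comes_from E psi A (conley_index E psi A) N N1 <-> index_pair psi A N N1.
Proof.
split=> [[]//|ip]; split=> //; exists N, N1; split=> //.
by split; exact: pointed_homotopy_equivalent_refl.
Qed.

(** The exit set being empty, a point of [B] whose orbit left [B] would have no
    exit point. *)
Lemma index_of_attractorP psi A : is_flow psi ->
  index_of_attractor E psi A (conley_index E psi A) <-> trapping psi A.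
Proof.
move=> fpsi; split=> [[B /comes_from_conley_index ip]|[K [isoK pK]]].
  have cB := compact_closed hM (index_pair_compact ip).
  exists B; split.
    by have := index_pair_isolating ip; rewrite setD0 -(closure_id B).1.
  move=> x t Bx t0; apply: contrapT => nB.
  have t_gt0 : 0 < t.
    rewrite lt_def t0 andbT; apply/eqP => t00; apply: nB.
    by rewrite t00; case: (fpsi) => _ -> _.
  by have [s [_ _ []]] := index_pair_exit ip Bx t_gt0 nB.
have cK := isolating_closed isoK.
exists K; apply/comes_from_conley_index; split=> //.
- by case: isoK => -[].
- exact: compact0.
- by rewrite setD0 -(closure_id K).1.
- by move=> x t Kx /ltW t0 /(_ (pK _ _ Kx t0)).
Qed.

(** For the direct implication, an orbit of the reversed flow starting in
    [interior B] that left it would first reach [boundary B]; read backwards, it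
    would be an orbit of [psi] running inside [B] from the boundary to the
    interior, but an orbit cannot leave the exit set while staying in [B].
    Conversely, if the reversed flow cannot leave [interior K], then [psi] cannot
    enter it, and leaves [K] through the boundary. *)
Lemma index_of_repellerP psi A : is_flow psi ->
  index_of_repeller E psi A (conley_index E psi A) <->
  trapping (reverse_flow psi) A.
Proof.
move=> fpsi; have fphi := reverse_is_flow fpsi.
set phi := reverse_flow psi in fphi *.
have psiE : psi = reverse_flow phi by rewrite /phi reverse_flowK.
have DB B : B `\` boundary B = interior B.
  apply/seteqP; split=> x.
    move=> [Bx nb]; apply: contrapT => nI; apply: nb; split=> //.
    exact: subset_closure.
  by move=> Ix; split; [exact: interior_subset|case].
split=> [[B /comes_from_conley_index ip]|[K [isoK pK]]].
  have cB := compact_closed hM (index_pair_compact ip).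
  exists (closure (interior B)); split.
    rewrite -DB; apply/isolating_neighbourhood_reverse.
    exact: index_pair_isolating ip.
  apply: positively_invariant_closure => // x t Ix t0; apply: contrapT => nI.
  have [s [/andP[s0 st] nIs Is segB]] :=
    first_exit_interior fphi cB (interior_subset Ix) t0 nI.
  have [s00|s_neq0] := eqVneq s 0.
    by apply: nIs; rewrite s00; case: (fphi) => _ -> _.
  have s_gt0 : 0 < s by rewrite lt_def s_neq0.
  have Bs : B (phi s x).
    by apply: segB; exists s => //=; rewrite in_itv/= s0 lexx.
  have bs : boundary B (phi s x) by split=> //; exact: subset_closure.
  have back r : psi r (phi s x) = phi (s - r) x.
    by rewrite psiE /reverse_flow; case: (fphi) => _ _ <-; rewrite addrC.
  have seg : orbit_segment psi s (phi s x) `<=` B.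
    move=> _ [r /= + <-]; rewrite in_itv/= => /andP[r0 rs]; rewrite back.
    have [->|r_neq0] := eqVneq r 0; first by rewrite subr0.
    apply: interior_subset; apply: Is.
    by rewrite subr_ge0 rs ltrBlDr ltrDl lt_def r_neq0.
  have /(_ x) := index_pair_positive ip bs s_gt0 seg.
  case=> //; exists s; first by rewrite /= in_itv/= lexx s0.
  by rewrite back subrr; case: (fphi) => _ -> _.
have cK := isolating_closed isoK.
have pI := positively_invariant_interior fphi pK.
have [[cptK EK] _ _] := isoK.
exists K; apply/comes_from_conley_index; split=> //.
- apply/closed_compact; rewrite /boundary setDE.
  apply: closedI; first exact: closed_closure.
  by apply: open_closedC; exact: open_interior.
- by move=> x [+ _]; exact: cK.
- by rewrite DB -EK; apply/isolating_neighbourhood_reverse.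
- move=> x t [_ nIx] t0 seg _ [s /= st <-]; split.
    by apply: subset_closure; apply: seg; exists s.
  move=> Is; apply: nIx; move: st; rewrite in_itv/= => /andP[s0 _].
  by have := pI _ _ Is s0; rewrite /phi /reverse_flow flowK.
- move=> x t Kx /ltW t0 nK.
  have nI : ~ interior K (psi t x) by move=> /interior_subset.
  have [s [/andP[s0 st] nIs _ seg]] := first_exit_interior fpsi cK Kx t0 nI.
  exists s; split=> //; first by rewrite s0.
  split=> //; apply: subset_closure; apply: seg.
  by exists s => //=; rewrite in_itv/= s0 lexx.
Qed.

(** * Connecting orbits *)

Lemma dyn_complement_disjoint phi S : is_flow phi -> closed S ->
  invariant_set phi S -> dyn_complement phi S `&` S = set0.
Proof.
move=> fphi cS iS; apply/seteqP; split=> // x [[_ oS] Sx].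
have [y oy] := omega_limit_neq0 phi x.
suff: set0 y by []; rewrite -oS; split=> //.
exact: (closed_invariant_omega_limit fphi cS iS Sx oy).
Qed.

(** A point outside the dynamical complement has a limit set meeting [S]. If its
    omega-limit set lies in the complement, that is the alpha-limit set. *)
Lemma arrival_connects phi S x : is_flow phi -> closed S ->
  invariant_set phi S -> ~ dyn_complement phi S x ->
  omega_limit phi x `<=` dyn_complement phi S ->
  [/\ (~` (S `|` dyn_complement phi S)) x, alpha_limit phi x `&` S !=set0
    & omega_limit phi x `<=` dyn_complement phi S].
Proof.
move=> fphi cS iS nCx oC; have CS0 := dyn_complement_disjoint fphi cS iS.
have oS0 : omega_limit phi x `&` S = set0.
  by apply/seteqP; split=> // y [/oC Cy Sy]; suff: set0 y by []; rewrite -CS0.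
split=> // [[Sx|//]|].
  have [y oy] := omega_limit_neq0 phi x.
  suff: set0 y by []; rewrite -oS0; split=> //.
  exact: (closed_invariant_omega_limit fphi cS iS Sx oy).
by apply/set0P/eqP => aS0; apply: nCx.
Qed.

Lemma trapping_connection phi S : is_flow phi -> closed S ->
  invariant_set phi S -> connected [set: M] ->
  trapping phi (dyn_complement phi S) ->
  (S !=set0 -> dyn_complement phi S !=set0 ->
    exists x, [/\ (~` (S `|` dyn_complement phi S)) x,
                  alpha_limit phi x `&` S !=set0
                & omega_limit phi x `<=` dyn_complement phi S]) /\
  ~ (exists x, [/\ (~` (S `|` dyn_complement phi S)) x,
                   alpha_limit phi x `<=` dyn_complement phi S
                 & omega_limit phi x `&` S !=set0]).
Proof.
move=> fphi cS iS coM tC; have CS0 := dyn_complement_disjoint fphi cS iS.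
split=> [[s Ss] C0|[x [_ aC oS]]]; last first.
  exact: (trapping_no_departure fphi tC CS0 aC oS).
have CT : dyn_complement phi S != setT.
  by apply/eqP => CT; suff: set0 s by []; rewrite -CS0 CT.
have [x [nCx oC]] := trapping_arrival fphi tC coM C0 CT.
by exists x; exact: arrival_connects.
Qed.

Lemma not_trapping_connection phi S : is_flow phi -> closed S ->
  invariant_set phi S -> isolated_invariant phi (dyn_complement phi S) ->
  ~ trapping (reverse_flow phi) (dyn_complement phi S) ->
  exists x, [/\ (~` (S `|` dyn_complement phi S)) x,
                alpha_limit phi x `&` S !=set0
              & omega_limit phi x `<=` dyn_complement phi S].
Proof.
move=> fphi cS iS isoC; apply: contra_notP => H; apply: trapping_reverse => //.
move=> x oC; apply: contrapT => nC; apply: H; exists x; exact: arrival_connects.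
Qed.

End CompactFlows.

(** * Topology of the hemisphere *)

Section Hemisphere.
Variables (R : realType) (X : normedModType R) (ip : X -> X -> R).
Hypothesis (ip_scal : scalar_product ip).

Let ipC u v : ip u v = ip v u. Proof. by case: ip_scal. Qed.
Let ipxx u : ip u u = `|u| ^+ 2. Proof. by case: ip_scal. Qed.
Let ip_lin v : scalar (ip ^~ v). Proof. by case: ip_scal. Qed.
Let ipDl u v w : ip (u + v) w = ip u w + ip v w.
Proof. by have := ip_lin w 1 u v; rewrite scale1r mul1r. Qed.
Let ip0l w : ip 0 w = 0.
Proof. by apply: (addrI (ip 0 w)); rewrite -ipDl !addr0. Qed.
Let ipZl a u w : ip (a *: u) w = a * ip u w.
Proof. by have := ip_lin w a u 0; rewrite !addr0 ip0l addr0. Qed.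
Let ipZr a u w : ip w (a *: u) = a * ip w u.
Proof. by rewrite ipC ipZl ipC. Qed.
Let ip_suml (r : seq X) (c : X -> R) w :
  ip (\sum_(z <- r) c z *: z) w = \sum_(z <- r) c z * ip z w.
Proof.
rewrite (big_morph (ip ^~ w) (fun u v => ipDl u v w) (ip0l w)).
by apply: eq_bigr => z _; exact: ipZl.
Qed.

(** The triangle inequality for the norm, squared and expanded. *)
Lemma Cauchy_Schwarz u v : `|ip u v| <= `|u| * `|v|.
Proof.
have H w : ip w v <= `|w| * `|v|.
  have := ipxx (w + v).
  rewrite ipDl ![ip _ (w + v)]ipC !ipDl !ipxx [ip v w]ipC => E.
  have : `|w + v| ^+ 2 <= (`|w| + `|v|) ^+ 2.
    by rewrite lerXn2r ?nnegrE ?addr_ge0 ?ler_normD.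
  by rewrite -E; nra.
rewrite ler_norml H andbT lerNl; have := H (- u).
by rewrite -scaleN1r ipZl mulN1r scaleN1r normrN.
Qed.

(** Gram-Schmidt orthonormalisation in a form that allows dependent vectors and
    does not record orthogonality: the resulting vectors may vanish, and what is
    kept is the expansion formula that orthonormal bases satisfy. The second
    clause replaces membership in the span of [e]: it carries over to [u] every
    orthogonality relation valid on [e]. *)
Lemma Gram_Schmidt (e : seq X) : exists u : seq X,
  [/\ forall z, z \in u -> `|z| <= 1,
      forall y, (forall x, x \in e -> ip y x = 0) ->
                forall z, z \in u -> ip y z = 0
    & forall x, x \in e -> x = \sum_(z <- u) ip x z *: z].
Proof.
elim: e => [|a e [u [u1 uperp Hu]]]; first by exists [::].
pose w := a - \sum_(z <- u) ip a z *: z.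
(* Expanding [x] along [u] shows that [a] and its projection have the same
   scalar product with [x]. *)
have w_e x : x \in e -> ip w x = 0.
  move=> xe; rewrite ipDl -scaleN1r ipZl ip_suml.
  rewrite ipC [in ip x a](Hu x xe) ip_suml mulN1r; apply/eqP.
  rewrite subr_eq0; apply/eqP; apply: eq_bigr => z _.
  by rewrite mulrC [ip z a]ipC [ip z x]ipC.
have w_u z : z \in u -> ip w z = 0 by exact: uperp.
have aw : ip a w = `|w| ^+ 2.
  have ww : ip w w = ip a w + -1 * \sum_(z <- u) ip a z * ip z w.
    by rewrite {1}/w ipDl -scaleN1r ipZl ip_suml.
  rewrite -ipxx ww big_seq big1 ?mulr0 ?addr0// => z zu.
  by rewrite [ip z w]ipC w_u ?mulr0.
exists (`|w|^-1 *: w :: u); split=> [z|y ye z|x].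
- rewrite inE => /predU1P[->|]; last exact: u1.
  rewrite normrZ normfV normr_id; have [->|w0] := eqVneq `|w| 0.
    by rewrite mulr0.
  by rewrite mulVf.
- have yu v : v \in u -> ip y v = 0.
    by apply: uperp => x xe; apply: ye; rewrite inE xe orbT.
  rewrite inE => /predU1P[->|]; last exact: yu.
  rewrite ipZr ipC ipDl -scaleN1r ipZl ip_suml ipC ye ?mem_head// add0r.
  rewrite big_seq big1 ?mulr0// => v vu.
  by rewrite [ip v y]ipC yu ?mulr0.
- rewrite big_cons ipZr scalerA inE => /predU1P[->|xe].
    rewrite aw; have [w0|w0] := eqVneq `|w| 0.
      rewrite w0 invr0 mul0r mul0r scale0r add0r.
      by move/normr0_eq0 : w0 => /eqP; rewrite subr_eq0 => /eqP.
    have -> : `|w|^-1 * `|w| ^+ 2 * `|w|^-1 = 1 by field.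
    by rewrite scale1r subrK.
  by rewrite ipC w_e// mulr0 mul0r scale0r add0r -Hu.
Qed.

Lemma compact_box (u : seq X) : exists2 C : set X, compact C &
  forall c : X -> R, (forall z, z \in u -> `|c z| <= 1) ->
    C (\sum_(z <- u) c z *: z).
Proof.
elim: u => [|a u [C cC HC]].
  by exists [set 0] => [|c _]; [exact: compact_set1|rewrite big_nil].
exists ((fun p : R * X => p.1 *: a + p.2) @` (`[-1, 1] `*` C)).
  apply: continuous_compact; last first.
    by apply: compact_setX => //; exact: segment_compact.
  apply: continuous_subspaceT => p; apply: cvgD; last exact: cvg_snd.
  by apply: cvgZ; [exact: cvg_fst|exact: cvg_cst].
move=> c c1; exists (c a, \sum_(z <- u) c z *: z); last by rewrite big_cons.
split=> /=; last by apply: HC => z zu; apply: c1; rewrite inE zu orbT.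
by rewrite in_itv/= -ler_norml c1// mem_head.
Qed.

(** By Cauchy-Schwarz, the coefficients of the vectors of the unit ball in a
    Gram-Schmidt system lie between -1 and 1. *)
Lemma unit_ball_in_compact : finite_dimensional X ->
  exists2 C : set X, compact C & forall x, `|x| <= 1 -> C x.
Proof.
move=> [m [e He]].
have [u [u1 _ Hu]] := Gram_Schmidt [seq e i | i <- enum 'I_m].
have [C cC HC] := compact_box u; exists C => // x x1.
have -> : x = \sum_(z <- u) ip x z *: z.
  have [c ->] := He x; under [RHS]eq_bigr => z _ do
    rewrite (big_morph (ip ^~ z) (fun u v => ipDl u v z) (ip0l z)) scaler_suml.
  rewrite exchange_big; apply: eq_bigr => i _ /=.
  rewrite {1}[e i]Hu ?map_f ?mem_enum// scaler_sumr.
  by apply: eq_bigr => z _; rewrite scalerA ipZl.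
apply: HC => z zu; apply: le_trans (Cauchy_Schwarz _ _) _.
by rewrite mulr_ile1 ?normr_ge0 ?x1 ?u1.
Qed.

Let height (x : X) : R := Num.sqrt (1 - `|x| ^+ 2).
(* Retracting first makes the lift a total function on [X], so that its
   continuity needs no restriction to the ball. *)
Let retract (x : X) : X := (Num.max 1 `|x|)^-1 *: x.

Let retract_norm x : `|retract x| <= 1.
Proof.
rewrite normrZ normfV ger0_norm ?le_max ?ler01// mulrC ler_pdivrMr ?mul1r.
  by rewrite le_max lexx orbT.
by rewrite lt_max ltr01.
Qed.

Let retract_id x : `|x| <= 1 -> retract x = x.
Proof. by move=> x1; rewrite /retract max_l// invr1 scale1r. Qed.

Let lift_subproof x : hemisphere ip (retract x, height (retract x)).
Proof.
split=> /=; last exact: sqrtr_ge0.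
have r1 : `|retract x| ^+ 2 <= 1.
  by apply: exprn_ile1; [exact: normr_ge0|exact: retract_norm].
by rewrite ipxx /height sqr_sqrtr ?subr_ge0// addrC subrK.
Qed.

Let lift x : hemisphere ip := SigSub (mem_set (lift_subproof x)).

Let lift_continuous : continuous lift.
Proof.
have cr : continuous retract.
  move=> x; apply: cvgZ; last exact: cvg_id.
  apply: cvgV; first by rewrite gt_eqF// lt_max ltr01.
  apply: (@continuous_max _ _ (fun=> 1) (fun x => `|x|)); first exact: cvg_cst.
  exact: norm_continuous.
have ch : continuous (fun x => height (retract x)).
  move=> x; apply: (@continuous_comp _ _ _ (fun x => 1 - `|retract x| ^+ 2)
    Num.sqrt); last exact: sqrt_continuous.
  apply: cvgB; first exact: cvg_cst.
  apply: (@continuous_comp _ _ _ (fun x => `|retract x|) (fun y => y ^+ 2)).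
    by apply: continuous_comp; [exact: cr|exact: norm_continuous].
  exact: exprn_continuous.
apply/continuousP => _ [B oB <-].
have c2 : continuous (fun x => (retract x, height (retract x))).
  by move=> x; apply: (cvg_pair (cr x) (ch x)).
by move/continuousP : c2; apply.
Qed.

Let liftE (p : hemisphere ip) : lift (set_val p).1 = p.
Proof.
case: p => -[x z] /[dup]/set_mem[/= xz z0] pH.
apply: val_inj => /=.
move: xz; rewrite ipxx => xz.
have x1 : `|x| <= 1 by rewrite -(@expr_le1 _ 2)// -xz lerDl sqr_ge0.
by rewrite retract_id// /height -xz addrAC subrr add0r sqrtr_sqr ger0_norm.
Qed.

Lemma hemisphere_compact : finite_dimensional X ->
  compact [set: hemisphere ip].
Proof.
move=> /unit_ball_in_compact[C cC HC].
have -> : [set: hemisphere ip] = lift @` C.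
  apply/seteqP; split=> // p _; exists (set_val p).1; last exact: liftE.
  apply: HC; case: p => -[x z] /[dup]/set_mem[/= xz z0] pH.
  by rewrite /= -(@expr_le1 _ 2)// -xz -ipxx lerDl sqr_ge0.
by apply: continuous_compact cC; exact: continuous_subspaceT.
Qed.

(** The lifts of the segments joining the points of [X] to the origin all go
    through the pole. *)
Lemma hemisphere_connected : connected [set: hemisphere ip].
Proof.
have -> : [set: hemisphere ip] =
    \bigcup_(x in [set: X]) ((fun t : R => lift (t *: x)) @` `[0, 1]).
  apply/seteqP; split=> // p _; exists (set_val p).1 => //.
  by exists 1; [rewrite /= in_itv/= ler01 lexx|rewrite scale1r liftE].
apply: bigcup_connected.
  exists (lift 0) => x _; exists 0; last by rewrite scale0r.
  by rewrite /= in_itv/= ler01 lexx.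
move=> x _; apply: connected_continuous_connected.
  exact: segment_connected.
apply: continuous_subspaceT => t; apply: continuous_comp; last first.
  exact: lift_continuous.
by apply: cvgZ; [exact: cvg_id|exact: cvg_cst].
Qed.

Lemma hemisphere_hausdorff : hausdorff_space (hemisphere ip).
Proof.
move=> p q pq; apply: val_inj.
have hXR : hausdorff_space (X * R)%type by exact: norm_hausdorff.
apply: hXR => A B nA nB.
have [r [Ar Br]] := pq _ _ (initial_continuous nA) (initial_continuous nB).
by exists (set_val r).
Qed.

End Hemisphere.

(** * The index at infinity and connections with infinity *)

Theorem theorem3p16 (R : realType) (X : normedModType R) (ip : X -> X -> R)
    (X_fin : finite_dimensional X) (ip_scal : scalar_product ip)
    (phi : R -> hemisphere ip -> hemisphere ip) (phi_flow : normalized_flow phi)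
    (S : set (hemisphere ip)) (S_inf : S `<=` equator ip) (S_closed : closed S)
    (S_inv : invariant_set phi S)
    (S_iso : isolated_invariant phi (dyn_complement phi S)) :
  [/\ infinity_repeller (equator ip) phi S ->
        (S !=set0 -> dyn_complement phi S !=set0 ->
          exists x, [/\ (~` (S `|` dyn_complement phi S)) x,
                        alpha_limit phi x `&` S !=set0
                      & omega_limit phi x `<=` dyn_complement phi S]) /\
        ~ (exists x, [/\ (~` (S `|` dyn_complement phi S)) x,
                         alpha_limit phi x `<=` dyn_complement phi S
                       & omega_limit phi x `&` S !=set0]),
      infinity_attractor (equator ip) phi S ->
        (S !=set0 -> dyn_complement phi S !=set0 ->
          exists x, [/\ (~` (S `|` dyn_complement phi S)) x,
                        alpha_limit phi x `<=` dyn_complement phi S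
                      & omega_limit phi x `&` S !=set0]) /\
        ~ (exists x, [/\ (~` (S `|` dyn_complement phi S)) x,
                         alpha_limit phi x `&` S !=set0
                       & omega_limit phi x `<=` dyn_complement phi S])
    & ~ infinity_attractor (equator ip) phi S ->
      ~ infinity_repeller (equator ip) phi S ->
        (exists x, [/\ (~` (S `|` dyn_complement phi S)) x,
                       alpha_limit phi x `&` S !=set0
                     & omega_limit phi x `<=` dyn_complement phi S]) /\
        (exists y, [/\ (~` (S `|` dyn_complement phi S)) y,
                       alpha_limit phi y `<=` dyn_complement phi S
                     & omega_limit phi y `&` S !=set0])].
Proof.
have [fphi _] := phi_flow; have fpsi := reverse_is_flow fphi.
have cM := hemisphere_compact ip_scal X_fin.
have coM := hemisphere_connected ip_scal.
have hM := @hemisphere_hausdorff R X ip.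
have S_inv' : invariant_set (reverse_flow phi) S by apply/invariant_set_reverse.
have repP : infinity_repeller (equator ip) phi S <->
    trapping phi (dyn_complement phi S).
  by rewrite -[X in trapping X]reverse_flowK; exact: index_of_repellerP.
have attP : infinity_attractor (equator ip) phi S <->
    trapping (reverse_flow phi) (dyn_complement phi S).
  exact: index_of_attractorP.
split=> [/repP tC|/attP tC|/attP natt /repP nrep].
- exact: trapping_connection.
- have := @trapping_connection _ _ cM hM _ _ fpsi S_closed S_inv' coM.
  rewrite dyn_complement_reverse => /(_ tC)[H1 H2]; split=> [S0 C0|[x Hx]].
    have [x Hx] := H1 S0 C0; exists x; case: Hx.
    by rewrite alpha_limit_reverse omega_limit_reverse.
  apply: H2; exists x; case: Hx.
  by rewrite alpha_limit_reverse omega_limit_reverse.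
- split; first exact: not_trapping_connection.
  have [K isoK] := S_iso.
  have := @not_trapping_connection _ _ cM hM _ _ fpsi S_closed S_inv'.
  rewrite dyn_complement_reverse reverse_flowK => /(_ _ nrep)[].
    by exists K; apply/isolating_neighbourhood_reverse.
  move=> y []; rewrite alpha_limit_reverse omega_limit_reverse.
  by exists y.
Qed.
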